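(* Let $r\geqslant 2$ be an integer and $n\geqslant 1$. Define numbers $\alpha^+_{n,k;r},\alpha^-_{n,k;r}$ by $\alpha^+_{1,0;r}=1$, $\alpha^-_{1,0;r}=r-2$, $\alpha^+_{1,k;r}=\alpha^-_{1,k;r}=0$ for $k\neq0$, and $$\alpha^+_{n+1,k;r}=(1+rk)\alpha^+_{n,k;r}+2r(n-2k+2)\alpha^+_{n,k-1;r}+2\alpha^-_{n,k-1;r},$$ $$\alpha^-_{n+1,k;r}=(r-2)\alpha^+_{n,k;r}+(r-1+rk)\alpha^-_{n,k;r}+2r(n-2k+1)\alpha^-_{n,k-1;r}$$ (with terms of negative index equal to $0$). Then the $r$-colored Eulerian polynomial $A_{n,r}(x)$ is bi-$\gamma$-positive; more precisely, $$A_{n,r}(x)=\sum_{k=0}^{\lfloor n/2\rfloor}\alpha^+_{n,k;r}x^k(1+x)^{n-2k}+x\sum_{k=0}^{\lfloor (n-1)/2\rfloor}\alpha^-_{n,k;r}x^k(1+x)^{n-1-2k}.$$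
   Context: An $r$-colored permutation of order $n$ is $\pi^c=\pi_1^{c_1}\cdots\pi_n^{c_n}$ with $\pi=\pi_1\cdots\pi_n\in\mathcal{S}_n$ and colors $c_i\in\{0,1,\dots,r-1\}$; $\mathbb{Z}_r\wr\mathcal{S}_n$ is the set of these. Using the total order $1<_f1^{[1]}<_f\cdots<_f1^{[r-1]}<_f2<_f2^{[1]}<_f\cdots<_fn^{[r-1]}$ on colored letters ($i^{[c]}$ = letter $i$ with color $c$), the index $i$ is an excedance of $\pi^c$ if $i<_f\pi_i^{c_i}$ (i.e. $\pi_i>i$, or $\pi_i=i$ and $c_i>0$); $\mathrm{exc}(\pi^c)$ is their number, and $A_{n,r}(x)=\sum_{\pi^c\in\mathbb{Z}_r\wr\mathcal{S}_n}x^{\mathrm{exc}(\pi^c)}$. Bi-$\gamma$-positive means an expansion of the displayed form with all coefficients nonnegative. *)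

(* Defs.v *)
From HB Require Import structures.
From mathcomp Require Import all_boot all_order all_algebra all_fingroup.

Set Implicit Arguments.
Unset Strict Implicit.
Unset Printing Implicit Defensive.

Import Order.TTheory GRing.Theory Num.Theory.
Local Open Scope ring_scope.

(* Letters and positions are numbered from 0, i.e. by 'I_n; the shift by one
   does not affect any comparison. *)
Definition colored_perm (n r : nat) : finType := ('S_n * {ffun 'I_n -> 'I_r})%type.

(* The pair (i, c) is the letter i with color c, and <_f is the lexicographic
   order (first the letter, then the color). *)
Definition ltf (a b : nat * nat) : bool :=
  ((a : (nat *l nat)%type) < (b : (nat *l nat)%type))%O.

Lemma ltfE (i c j d : nat) :
  ltf (i, c) (j, d) = (i < j)%N || ((i == j) && (c < d)%N).
Proof.
by rewrite /ltf ltxi_pair !leEnat ltEnat leq_eqVlt; case: ltngtP.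
Qed.

(* An uncolored letter i is the letter i with color 0. *)
Definition exc (n r : nat) (w : colored_perm n r) : nat :=
  #|[set i : 'I_n | ltf (i : nat, 0%N) (w.1 i : nat, w.2 i : nat)]|.

Definition colored_eulerian (n r : nat) : {poly int} :=
  \sum_(w : colored_perm n r) 'X^(exc w).

Definition bi_gamma_expansion (n : nat) (a b : nat -> int) : {poly int} :=
  \sum_(k < n./2.+1) (a k)%:P * 'X^k * (1 + 'X) ^+ (n - 2 * k)
  + 'X * \sum_(k < (n - 1)./2.+1) (b k)%:P * 'X^k * (1 + 'X) ^+ (n - 1 - 2 * k).

Definition nonneg_coefs (n : nat) (a b : nat -> int) : Prop :=
  (forall k : nat, (k <= n./2)%N -> 0 <= a k) /\
  (forall k : nat, (k <= (n - 1)./2)%N -> 0 <= b k).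

Definition bi_gamma_positive (n : nat) (p : {poly int}) : Prop :=
  exists a b : nat -> int, nonneg_coefs n a b /\ p = bi_gamma_expansion n a b.

(* [prev f k] is f (k - 1), with terms of negative index equal to 0. *)
Definition prev (f : nat -> int) (k : nat) : int := if k is j.+1 then f j else 0.

(* [alpha r n] is the pair of sequences (k |-> alpha^+_{n,k;r},
   k |-> alpha^-_{n,k;r}) for n >= 1; the value at n = 0 is irrelevant.
   All coefficients are computed in int, so no subtraction is truncated. *)
Fixpoint alpha (r n : nat) : (nat -> int) * (nat -> int) :=
  match n with
  | 0 => (fun=> 0, fun=> 0)
  | 1 => (fun k => if k == 0%N then 1 else 0,
          fun k => if k == 0%N then r%:Z - 2 else 0)
  | (_.+1 as m).+1 =>
    let ap := (alpha r m).1 in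
    let am := (alpha r m).2 in
    (fun k => (1 + r%:Z * k%:Z) * ap k
              + 2 * r%:Z * (m%:Z - 2 * k%:Z + 2) * prev ap k
              + 2 * prev am k,
     fun k => (r%:Z - 2) * ap k
              + (r%:Z - 1 + r%:Z * k%:Z) * am k
              + 2 * r%:Z * (m%:Z - 2 * k%:Z + 1) * prev am k)
  end.

Definition alpha_plus (r n k : nat) : int := (alpha r n).1 k.
Definition alpha_minus (r n k : nat) : int := (alpha r n).2 k.

Lemma alpha_plusS (r n k : nat) : (0 < n)%N ->
  alpha_plus r n.+1 k =
    (1 + r%:Z * k%:Z) * alpha_plus r n k
    + 2 * r%:Z * (n%:Z - 2 * k%:Z + 2) * prev (alpha_plus r n) k
    + 2 * prev (alpha_minus r n) k.
Proof. by case: n. Qed.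

Lemma alpha_minusS (r n k : nat) : (0 < n)%N ->
  alpha_minus r n.+1 k =
    (r%:Z - 2) * alpha_plus r n k
    + (r%:Z - 1 + r%:Z * k%:Z) * alpha_minus r n k
    + 2 * r%:Z * (n%:Z - 2 * k%:Z + 1) * prev (alpha_minus r n) k.
Proof. by case: n. Qed.

(* Main.v *)
(* Inserting the largest letter into the cycle structure gives
   A_(n+1) = (1 + (r n + r - 1) x) A_n + r x (1 - x) A_n'.  Applied to
   x^k (1+x)^(n-2k) and to x x^k (1+x)^(n-1-2k), this operator produces only
   terms of the same two shapes for n + 1, with exactly the coefficients of the
   recurrences for alpha^+ and alpha^-.  For r >= 2 those are nonnegative in the
   relevant range of k, outside of which alpha^+ and alpha^- vanish. *)
Require Import Defs.
From HB Require Import structures.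
From mathcomp Require Import all_boot all_order all_algebra all_fingroup.
From mathcomp Require Import zify ring.

Set Implicit Arguments.
Unset Strict Implicit.
Unset Printing Implicit Defensive.

Import Order.TTheory GRing.Theory Num.Theory.
Local Open Scope ring_scope.

(** * The differential operator of the Eulerian recurrence *)

Definition euler_step (r n : nat) (p : {poly int}) : {poly int} :=
  (1 + (r%:R * n%:R + r%:R - 1) * 'X) * p + r%:R * 'X * (1 - 'X) * p^`().

Lemma euler_step_sum (r n : nat) (I : Type) (s : seq I) (F : I -> {poly int}) :
  euler_step r n (\sum_(i <- s) F i) = \sum_(i <- s) euler_step r n (F i).
Proof. by rewrite /euler_step raddf_sum !mulr_sumr -big_split. Qed.

Lemma euler_stepD (r n : nat) (p q : {poly int}) :
  euler_step r n (p + q) = euler_step r n p + euler_step r n q.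
Proof. by rewrite /euler_step derivD; ring. Qed.

Lemma euler_stepC (r n : nat) (c : int) (p : {poly int}) :
  euler_step r n (c%:P * p) = c%:P * euler_step r n p.
Proof. by rewrite /euler_step derivM derivC; ring. Qed.

Lemma mulX_derivXn (e : nat) : 'X * ('X^e)^`() = e%:R * 'X^e :> {poly int}.
Proof.
rewrite derivXn; case: e => [|e]; first by rewrite mulr0n mulr0 mul0r.
by rewrite /= -mulr_natl exprS; ring.
Qed.

(** * Insertion of the largest letter and its effect on excedances *)

(* The letter n with color t.2.1 is put at position t.2.2, and the colored
   letter that stood there moves to position n. *)
Definition insert_max (n r : nat) (t : colored_perm n r * ('I_r * 'I_n.+1)) :
    colored_perm n.+1 r :=
  ((tperm t.2.2 ord_max * lift_perm ord_max ord_max t.1.1)%g,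
   [ffun x => if unlift ord_max (tperm t.2.2 ord_max x) is Some i
              then t.1.2 i else t.2.1]).

(** The insertion position is the preimage of the largest letter. Once it is known, the
    transposition cancels, and the new color and the old data are read off at [ord_max] and at the
    lifted positions. *)
Lemma insert_max_inj (n r : nat) : injective (@insert_max n r).
Proof.
move=> [[p c] [d j]] [[q c'] [d' j']] [/= Ep Ec].
have Ej : j = j'.
  apply: (@perm_inj _ (tperm j ord_max * lift_perm ord_max ord_max p)%g).
  by rewrite [in RHS]Ep !permM !tpermL !lift_perm_id.
subst j'; have {}Ep := mulgI _ _ _ Ep.
have Ec0 x : (if unlift ord_max x is Some i then c i else d)
           = (if unlift ord_max x is Some i then c' i else d').
  by move/ffunP/(_ (tperm j ord_max x)): Ec; rewrite !ffunE tpermK.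
have <- : d = d' by have := Ec0 ord_max; rewrite unlift_none.
have <- : c = c'.
  by apply/ffunP => i; have := Ec0 (lift ord_max i); rewrite liftK.
have -> // : p = q.
apply/permP => i; apply: (@lift_inj _ ord_max).
by rewrite -!(lift_perm_lift ord_max) Ep.
Qed.

Lemma insert_max_bij (n r : nat) : bijective (@insert_max n r).
Proof.
apply: inj_card_bij; first exact: insert_max_inj.
rewrite !card_prod !card_Sn !card_ffun !card_ord factS expnS; lia.
Qed.

Lemma exc_sum (n r : nat) (w : colored_perm n r) :
  exc w = (\sum_(i < n) ltf (i : nat, 0%N) (w.1 i : nat, w.2 i : nat))%N.
Proof. by rewrite /exc cardsE -sum1_card big_mkcond. Qed.

Lemma exc_insert_fix (n r : nat) (w : colored_perm n r) (d : 'I_r) :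
  exc (insert_max (w, (d, ord_max))) = (exc w + (0 < d))%N.
Proof.
rewrite !exc_sum (bigD1_ord ord_max) //= addnC; congr addn.
  apply: eq_bigr => i _.
  rewrite (lift_max i : bump n i = i).
  by rewrite ffunE tperm1 mul1g perm1 liftK lift_perm_lift lift_max.
by rewrite ffunE tperm1 mul1g perm1 unlift_none lift_perm_id ltfE ltnn eqxx.
Qed.

(** Position i now holds the largest letter, an excedance whatever its color; the displaced letter
    lands at position n, above it, and is none. So the count grows exactly when i was not an
    excedance. *)
Lemma exc_insert_lift (n r : nat) (w : colored_perm n r) (d : 'I_r) (i : 'I_n) :
  exc (insert_max (w, (d, lift ord_max i))) =
  (exc w + ~~ ltf (i : nat, 0%N) (w.1 i : nat, w.2 i : nat))%N.
Proof.
rewrite !exc_sum (bigD1_ord ord_max) //=.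
rewrite ffunE permM tpermR liftK lift_perm_lift lift_max ltfE.
have -> : (n < w.1 i)%N = false by have := ltn_ord (w.1 i); lia.
have -> : (n == w.1 i :> nat) = false by have := ltn_ord (w.1 i); lia.
rewrite add0n (bigD1 i) //= [in RHS](bigD1 i) //=.
rewrite permM tpermL lift_perm_id ltfE (lift_max i : bump n i = i) ltn_ord /=.
rewrite [in RHS]addnAC; congr addn; first by case: ltf.
apply: eq_bigr => k ki.
rewrite (lift_max k : bump n k = k).
rewrite ffunE permM tpermD ?liftK ?lift_perm_lift ?lift_max //.
  by rewrite (inj_eq (@lift_inj _ _)) eq_sym.
exact: neq_lift.
Qed.

Lemma colored_eulerian0 (r : nat) : colored_eulerian 0 r = 1.
Proof.
rewrite /colored_eulerian (eq_bigr (fun=> 1)) => [|w _].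
  by rewrite sumr_const card_prod card_Sn card_ffun !card_ord.
by rewrite exc_sum big_ord0.
Qed.

(** A [w] with e excedances contributes x^e times 1 + (r-1)x from the last position and r(e +
    (n-e)x) from the others. The total is 1 + (rn+r-1)x + re(1-x), and e x^e = x (x^e)'. *)
Lemma colored_eulerianS (r n : nat) : (0 < r)%N ->
  colored_eulerian n.+1 r = euler_step r n (colored_eulerian n r).
Proof.
case: r => // r _; rewrite /colored_eulerian euler_step_sum.
rewrite (reindex _ (onW_bij _ (insert_max_bij n r.+1))) /=.
rewrite -(pair_bigA _ (fun w t => 'X^(exc (insert_max (w, t))))) /=.
apply: eq_bigr => w _.
rewrite -(pair_bigA _ (fun d j => 'X^(exc (insert_max (w, (d, j)))))) /=.
under eq_bigr => d _ do rewrite (bigD1_ord ord_max) //= exc_insert_fix exprD.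
rewrite big_split /= -mulr_sumr big_ord_recl /= expr0.
under eq_bigr => d _ do rewrite /= expr1.
rewrite sumr_const card_ord.
under [X in _ + X]eq_bigr => d _.
  under eq_bigr => i _.
    rewrite exc_insert_lift exprD.
    (* Being affine in b, this form makes the sum over positions depend on [exc w] alone. *)
    have -> b : 'X^(~~ b) = 'X + (1 - 'X) * b%:R :> {poly int}.
      by case: b; rewrite ?expr1 ?expr0 ?mulr1 ?mulr0 ?addr0 // addrC subrK.
    over.
  rewrite -mulr_sumr big_split /= sumr_const card_ord -mulr_sumr -natr_sum.
  rewrite -exc_sum.
  over.
rewrite sumr_const card_ord /euler_step.
have := mulX_derivXn (exc w); move: ('X^(exc w)) => p Ep.
have -> : r.+1%:R * 'X * (1 - 'X) * p^`()
        = r.+1%:R * (1 - 'X) * ((exc w)%:R * p) by rewrite -Ep; ring.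
ring.
Qed.

(** * Gamma expansions and the action of the operator on them *)

(* The exponent n - 2 * k is truncated, so the sum is meaningful only when a
   vanishes for 2 * k > n; N is then any large enough bound. *)
Definition gamma_sum (N n : nat) (a : nat -> int) : {poly int} :=
  \sum_(k < N) (a k)%:P * 'X^k * (1 + 'X) ^+ (n - 2 * k).

Lemma gamma_sum_widen (N n : nat) (a : nat -> int) :
  (forall k : nat, (n < 2 * k)%N -> a k = 0) -> (n./2 < N)%N ->
  gamma_sum n./2.+1 n a = gamma_sum N n a.
Proof.
move=> a0 leN; rewrite /gamma_sum (big_ord_widen _ (fun k =>
  (a k)%:P * 'X^k * (1 + 'X) ^+ (n - 2 * k)) leN) big_mkcond.
apply: eq_bigr => k _; case: ifP => // lek.
by rewrite a0 ?mul0r //; lia.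
Qed.

Lemma gamma_sumD (N n : nat) (a b : nat -> int) :
  gamma_sum N n (fun k => a k + b k) = gamma_sum N n a + gamma_sum N n b.
Proof.
by rewrite -big_split; apply: eq_bigr => k _; rewrite polyCD !mulrDl.
Qed.

Lemma eq_gamma_sum (N n : nat) (a b : nat -> int) :
  a =1 b -> gamma_sum N n a = gamma_sum N n b.
Proof. by move=> ab; apply: eq_bigr => k _; rewrite ab. Qed.

Lemma gamma_sum_prev (N n : nat) (a : nat -> int) :
  gamma_sum N.+1 n (Defs.prev a)
  = \sum_(k < N) (a k)%:P * 'X^(k.+1) * (1 + 'X) ^+ (n - 2 * k.+1).
Proof. by rewrite /gamma_sum big_ord_recl /= !mul0r add0r. Qed.

Lemma gamma_sum_recr (N n : nat) (a : nat -> int) :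
  a N = 0 -> gamma_sum N.+1 n a = gamma_sum N n a.
Proof. by move=> aN; rewrite /gamma_sum big_ord_recr /= aN !mul0r addr0. Qed.

(** Write 1-x = 2-(1+x) in the term from the derivative of (1+x)^m. The factor left on x^k (1+x)^m
    is (1+rk) + (rk+r-1)x = (1+rk)(1+x) + (r-2)x. *)
Lemma euler_step_gamma (r k m : nat) :
  euler_step r (m + 2 * k) ('X^k * (1 + 'X) ^+ m)
  = (1 + r%:R * k%:R) * 'X^k * (1 + 'X) ^+ m.+1
    + 2 * r%:R * m%:R * 'X^(k.+1) * (1 + 'X) ^+ m.-1
    + (r%:R - 2) * 'X * 'X^k * (1 + 'X) ^+ m.
Proof.
rewrite /euler_step derivM [((1 + 'X) ^+ m)^`()]deriv_exp derivD derivC.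
rewrite derivX add0r mul1r.
have -> : forall D P Q : {poly int}, r%:R * 'X * (1 - 'X) * (D * P + Q)
   = r%:R * (1 - 'X) * (('X * D) * P + 'X * Q) by move=> *; ring.
rewrite mulX_derivXn natrD natrM.
(* For m = 0 the truncated [m.-1] is harmless, its term carrying the factor m. *)
case: m => [|m]; first by rewrite !mulr0n !expr0 !expr1 exprS; ring.
by rewrite /= -mulr_natl !exprS; ring.
Qed.

Lemma euler_step_gammaX (r k m : nat) :
  euler_step r (m + 2 * k).+1 ('X * ('X^k * (1 + 'X) ^+ m))
  = 2 * 'X^(k.+1) * (1 + 'X) ^+ m
    + (r%:R - 1 + r%:R * k%:R) * 'X * 'X^k * (1 + 'X) ^+ m.+1
    + 'X * (2 * r%:R * m%:R * 'X^(k.+1) * (1 + 'X) ^+ m.-1).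
Proof.
have E p : euler_step r (m + 2 * k).+1 ('X * p)
  = 'X * (euler_step r (m + 2 * k) p + r%:R * 'X * p)
    + r%:R * 'X * (1 - 'X) * p.
  by rewrite /euler_step derivM derivX -natr1; ring.
(* The terms of [E] outside the operator add up to r x p; then (r-2)x + r = (r-2)(1+x) + 2 splits
   between the two shapes. *)
rewrite E euler_step_gamma !exprS; ring.
Qed.

Lemma euler_step_gamma_sum (r n N : nat) (a : nat -> int) :
  (forall k : nat, (n < 2 * k)%N -> a k = 0) ->
  euler_step r n (gamma_sum N n a)
  = gamma_sum N n.+1 (fun k => (1 + r%:Z * k%:Z) * a k)
    + gamma_sum N.+1 n.+1
        (Defs.prev (fun k => 2 * r%:Z * (n%:Z - 2 * k%:Z) * a k))
    + 'X * gamma_sum N n (fun k => (r%:Z - 2) * a k).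
Proof.
move=> a0; rewrite gamma_sum_prev /gamma_sum euler_step_sum mulr_sumr.
rewrite -!big_split; apply: eq_bigr => k _ /=.
have [le_k|/a0->] := leqP (2 * k) n; last first.
  by rewrite !mulr0 !mul0r !mulr0 !addr0 /euler_step deriv0 !mulr0 addr0.
have [m En] : exists m, n = (m + 2 * k)%N by exists (n - 2 * k)%N; lia.
rewrite -mulrA euler_stepC En addnK euler_step_gamma.
have -> : ((m + 2 * k).+1 - 2 * k = m.+1)%N by lia.
have -> : ((m + 2 * k).+1 - 2 * k.+1 = m.-1)%N by lia.
have -> : (m + 2 * k)%:Z - 2 * k%:Z = m%:Z by lia.
by ring.
Qed.

Lemma euler_step_gamma_sumX (r n N : nat) (b : nat -> int) :
  (forall k, (n < 2 * k)%N -> b k = 0) ->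
  euler_step r n.+1 ('X * gamma_sum N n b)
  = gamma_sum N.+1 n.+2 (Defs.prev (fun k => 2 * b k))
    + 'X * (gamma_sum N n.+1 (fun k => (r%:Z - 1 + r%:Z * k%:Z) * b k)
    + gamma_sum N.+1 n.+1
        (Defs.prev (fun k => 2 * r%:Z * (n%:Z - 2 * k%:Z) * b k))).
Proof.
move=> b0; rewrite !gamma_sum_prev /gamma_sum mulr_sumr euler_step_sum.
rewrite -big_split mulr_sumr -big_split; apply: eq_bigr => k _ /=.
have [le_k|/b0->] := leqP (2 * k) n; last first.
  by rewrite !mulr0 !mul0r !mulr0 !addr0 /euler_step deriv0 !mulr0 addr0.
have [m En] : exists m, n = (m + 2 * k)%N by exists (n - 2 * k)%N; lia.
rewrite -mulrA mulrCA euler_stepC En addnK euler_step_gammaX.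
have -> : ((m + 2 * k).+1 - 2 * k = m.+1)%N by lia.
have -> : ((m + 2 * k).+1 - 2 * k.+1 = m.-1)%N by lia.
have -> : ((m + 2 * k).+2 - 2 * k.+1 = m)%N by lia.
have -> : (m + 2 * k)%:Z - 2 * k%:Z = m%:Z by lia.
by ring.
Qed.

(** * Support and sign of the coefficients *)

Lemma alpha_vanish (r n : nat) :
  (forall k, (n.+1 < 2 * k)%N -> alpha_plus r n.+1 k = 0) /\
  (forall k, (n < 2 * k)%N -> alpha_minus r n.+1 k = 0).
Proof.
elim: n => [|n [IHp IHm]]; first by split=> -[].
split=> -[|k] lt_k; try by rewrite muln0 in lt_k.
  rewrite alpha_plusS //= IHp; last by lia.
  rewrite [alpha_minus _ _ _]IHm; last by lia.
  (* The only case not covered by induction is 2k = n+1, where the factor of the recurrence is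
     zero. *)
  have [E|ltk] := leqP (2 * k) n.+1; last by rewrite IHp // !mulr0.
  have -> : n.+1%:Z - 2 * k.+1%:Z + 2 = 0 by lia.
  by rewrite !mulr0 mul0r.
rewrite alpha_minusS //= IHp; last by lia.
rewrite [alpha_minus _ _ k.+1]IHm; last by lia.
have [E|ltk] := leqP (2 * k) n; last by rewrite IHm // !mulr0.
have -> : n.+1%:Z - 2 * k.+1%:Z + 1 = 0 by lia.
by rewrite !mulr0 mul0r.
Qed.

Lemma alpha_ge0 (r n : nat) : (2 <= r)%N ->
  nonneg_coefs n.+1 (alpha_plus r n.+1) (alpha_minus r n.+1).
Proof.
move=> hr; elim: n => [|n [IHp IHm]].
  by split=> -[|k] _ //; rewrite /alpha_minus /= subr_ge0; lia.
(* Vanishing extends the sign to every index, so [prev] needs no range conditions. *)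
have {}IHp k : 0 <= alpha_plus r n.+1 k.
  have [/IHp//|lt_k] := leqP k n.+1./2.
  by rewrite (proj1 (alpha_vanish r n)) //; lia.
have {}IHm k : 0 <= alpha_minus r n.+1 k.
  have [/IHm//|lt_k] := leqP k (n.+1 - 1)./2.
  by rewrite (proj2 (alpha_vanish r n)) //; lia.
have prev_ge0 (f : nat -> int) k : (forall j, 0 <= f j) -> 0 <= Defs.prev f k.
  by case: k => [|k] f_ge0 //=.
have prevp k := prev_ge0 _ k IHp.
have prevm k := prev_ge0 _ k IHm.
split=> k le_k; [rewrite alpha_plusS // | rewrite alpha_minusS //].
  have c_ge0 : 0 <= n.+1%:Z - 2 * k%:Z + 2 by lia.
  (* Generalized so that [addr_ge0] does not split this factor into summands of mixed sign. *)
  move: (_ + 2) c_ge0 => c c_ge0.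
  by rewrite ?(addr_ge0, mulr_ge0).
have c_ge0 : 0 <= n.+1%:Z - 2 * k%:Z + 1 by lia.
have r1_ge0 : 0 <= r%:Z - 1 by lia.
have r2_ge0 : 0 <= r%:Z - 2 by lia.
move: (_ + 1) (_ - 1) (_ - 2) c_ge0 r1_ge0 r2_ge0.
move=> c r1 r2 c_ge0 r1_ge0 r2_ge0.
by rewrite ?(addr_ge0, mulr_ge0).
Qed.

(** * The expansion, by comparing recurrences *)

Lemma colored_eulerian_gamma_sum (r n N : nat) : (0 < r)%N -> (n < N)%N ->
  colored_eulerian n.+1 r
  = gamma_sum N n.+1 (alpha_plus r n.+1)
    + 'X * gamma_sum N n (alpha_minus r n.+1).
Proof.
move=> r_gt0; elim: n N => [|n IHn] [|N] // ltN.
  (* Order 1 comes from order 0: 1 + (r-1)x = (1+x) + (r-2)x. *)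
  rewrite colored_eulerianS // colored_eulerian0.
  have [vp vm] := alpha_vanish r 0.
  rewrite -(gamma_sum_widen vp) // -(gamma_sum_widen vm) //.
  rewrite /gamma_sum !big_ord_recl !big_ord0.
  rewrite /alpha_plus /alpha_minus /euler_step derivC /=.
  by ring.
have [vp vm] := alpha_vanish r n.
rewrite colored_eulerianS // (IHn N) //.
rewrite euler_stepD euler_step_gamma_sum // euler_step_gamma_sumX //.
(* The unshifted sums are padded by a zero term to the length N+1 of the shifted ones. *)
rewrite -[gamma_sum N n.+2 _]gamma_sum_recr; last by rewrite vp ?mulr0 //; lia.
rewrite -[gamma_sum N n.+1 _]gamma_sum_recr; last by rewrite vp ?mulr0 //; lia.
rewrite -[gamma_sum N n.+1 _]gamma_sum_recr; last by rewrite vm ?mulr0 //; lia.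
have -> : gamma_sum N.+1 n.+2 (alpha_plus r n.+2)
  = gamma_sum N.+1 n.+2 (fun k => (1 + r%:Z * k%:Z) * alpha_plus r n.+1 k)
  + gamma_sum N.+1 n.+2 (Defs.prev (fun k =>
      2 * r%:Z * (n.+1%:Z - 2 * k%:Z) * alpha_plus r n.+1 k))
  + gamma_sum N.+1 n.+2 (Defs.prev (fun k => 2 * alpha_minus r n.+1 k)).
  rewrite -!gamma_sumD; apply: eq_gamma_sum => -[|k].
    by rewrite alpha_plusS //= !mulr0.
  by rewrite alpha_plusS //= (_ : n.+1%:Z - 2 * k.+1%:Z + 2
                                 = n.+1%:Z - 2 * k%:Z) //; lia.
have -> : gamma_sum N.+1 n.+1 (alpha_minus r n.+2)
  = gamma_sum N.+1 n.+1 (fun k => (r%:Z - 2) * alpha_plus r n.+1 k)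
  + gamma_sum N.+1 n.+1 (fun k =>
      (r%:Z - 1 + r%:Z * k%:Z) * alpha_minus r n.+1 k)
  + gamma_sum N.+1 n.+1 (Defs.prev (fun k =>
      2 * r%:Z * (n%:Z - 2 * k%:Z) * alpha_minus r n.+1 k)).
  rewrite -!gamma_sumD; apply: eq_gamma_sum => -[|k].
    by rewrite alpha_minusS //= !mulr0.
  by rewrite alpha_minusS //= (_ : n.+1%:Z - 2 * k.+1%:Z + 1
                                  = n%:Z - 2 * k%:Z) //; lia.
by ring.
Qed.

Theorem theorem40 (r n : nat) (hr : (2 <= r)%N) (hn : (1 <= n)%N) :
  [/\ bi_gamma_positive n (colored_eulerian n r),
      nonneg_coefs n (alpha_plus r n) (alpha_minus r n)
    & colored_eulerian n r
      = bi_gamma_expansion n (alpha_plus r n) (alpha_minus r n)].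
Proof.
case: n hn => // n _.
have nonneg := alpha_ge0 n hr.
have expansion : colored_eulerian n.+1 r
  = bi_gamma_expansion n.+1 (alpha_plus r n.+1) (alpha_minus r n.+1).
  have [vp vm] := alpha_vanish r n.
  rewrite (@colored_eulerian_gamma_sum _ _ n.+1) //; last by lia.
  rewrite -(gamma_sum_widen vp); last by lia.
  by rewrite -(gamma_sum_widen vm) ?/bi_gamma_expansion ?subn1 //; lia.
by split=> //; exists (alpha_plus r n.+1), (alpha_minus r n.+1).
Qed.
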